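(* For every prime power $q>2$ there exists a strongly Deza graph with parameters $(q^2(q^2-q+1),\,q(q-1),\,1,\,0)$ whose spectrum consists of $q(q-1)$ with multiplicity $1$, $q$ with multiplicity $(q^4-q)/2-q^3+q^2$, $-1$ with multiplicity $q^3$, and $-q$ with multiplicity $(q^4-q)/2-q^3+q-1$. Moreover, its child $G_A$ is a strongly regular graph with parameters $(q^2(q^2-q+1),\,(q-1)(q+1)^2,\,2q^2-2,\,(q+1)^2)$.
   Context: All graphs are finite, simple and undirected; eigenvalues of a graph are those of its adjacency matrix. A Deza graph with parameters $(n,k,b,a)$, where $b\geqslant a$, is a $k$-regular graph on $n$ vertices, which is neither complete nor edgeless, such that any two distinct vertices have exactly $b$ or exactly $a$ common neighbours. If $b>a$, the children $G_A$ and $G_B$ of $G$ are the graphs on the vertex set of $G$ in which two distinct vertices are adjacent if and only if they have exactly $a$ (for $G_A$), respectively exactly $b$ (for $G_B$), common neighbours in $G$; if $b=a$, $G_A$ is the complete graph and $G_B$ is the edgeless graph. A strongly regular graph with parameters $(n,k,\lambda,\mu)$ is a $k$-regular graph on $n$ vertices, neither complete nor edgeless, in which any two adjacent vertices have exactly $\lambda$ common neighbours and any two distinct non-adjacent vertices have exactly $\mu$ common neighbours (disconnected examples, i.e. disjoint unions of at least two cliques of equal size, are allowed). A strongly Deza graph is a Deza graph both of whose children are strongly regular graphs. *)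

(* Defs.v *)
From mathcomp Require Import all_boot all_order all_algebra.
Set Implicit Arguments. Unset Strict Implicit. Unset Printing Implicit Defensive.
Import GRing.Theory Num.Theory.

Section Graphs.
Variable T : finType.

Definition simple_graph (e : rel T) : Prop :=
  symmetric e /\ irreflexive e.

Definition common_nbrs (e : rel T) (x y : T) : nat :=
  #|[set z | e x z && e y z]|.

Definition regular (e : rel T) (k : nat) : Prop :=
  forall x : T, #|[set y | e x y]| = k.

Definition is_complete (e : rel T) : Prop := forall x y : T, x != y -> e x y.
Definition is_edgeless (e : rel T) : Prop := forall x y : T, ~~ e x y.

Definition deza_graph (e : rel T) (n k b a : nat) : Prop :=
  simple_graph e /\ #|T| = n /\ regular e k /\
  ~ is_complete e /\ ~ is_edgeless e /\ a <= b /\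
  (forall x y : T, x != y -> common_nbrs e x y = b \/ common_nbrs e x y = a).

Definition childA (e : rel T) (b a : nat) : rel T :=
  fun x y => if a < b then (x != y) && (common_nbrs e x y == a) else x != y.
Definition childB (e : rel T) (b a : nat) : rel T :=
  fun x y => if a < b then (x != y) && (common_nbrs e x y == b) else false.

Definition srg (e : rel T) (n k lam mu : nat) : Prop :=
  simple_graph e /\ #|T| = n /\ regular e k /\
  ~ is_complete e /\ ~ is_edgeless e /\
  (forall x y : T, e x y -> common_nbrs e x y = lam) /\
  (forall x y : T, x != y -> ~~ e x y -> common_nbrs e x y = mu).

Definition is_srg (e : rel T) : Prop :=
  exists n k lam mu, srg e n k lam mu.

Definition strongly_deza (e : rel T) (n k b a : nat) : Prop :=
  [/\ deza_graph e n k b a, is_srg (childA e b a) & is_srg (childB e b a)].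

End Graphs.

Definition adjmx (n : nat) (e : rel 'I_n) : 'M[int]_n :=
  (\matrix_(i, j) (e i j)%:R)%R.

Definition prime_power (q : nat) : Prop :=
  exists p e : nat, [/\ prime p, 0 < e & q = p ^ e].

(* Main.v *)
Require Import Defs.
From mathcomp Require Import all_boot all_order all_algebra.
From HB Require Import structures.
From mathcomp Require Import finfield ring lra zify.
Set Implicit Arguments. Unset Strict Implicit. Unset Printing Implicit Defensive.
Import Order.TTheory GRing.Theory Num.Theory.
Local Open Scope ring_scope.

(** The graph is the orthogonality graph on the nonisotropic points of the
    Hermitian plane PG(2, q^2).  Two distinct points have a single point of the
    plane orthogonal to both, so they have 1 common neighbour, or 0 when that
    point is isotropic, i.e. when the line joining them is tangent to the unital.
    Let M be the incidence matrix of vertices against isotropic points under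
    orthogonality.  For a vertex x and an isotropic p, the closed neighbourhood
    of x contains exactly one vertex orthogonal to p, so (A + I) M = J, while
    M M^T = (q + 1) I + C with C the matrix of G_A.  Since
    C = (k - 1) I + J - A^2, this gives (A + I)(q^2 I - A^2) = (q - k) J, which
    yields the number of vertices, the parameters of both children and the
    eigenvalues; the multiplicities follow from the traces of A^0, ..., A^3. *)

(** * Diagonalizable matrices *)

Lemma char_poly_conj (F : fieldType) (n : nat) (P D : 'M[F]_n) :
  P \in unitmx -> char_poly (invmx P *m D *m P) = char_poly D.
Proof.
move=> Pu; pose f := map_mx (@polyC F) : 'M_n -> 'M_n.
have fVP : f (invmx P) *m f P = 1%:M by rewrite -map_mxM mulVmx // map_mx1.
rewrite /char_poly.
have -> : char_poly_mx (invmx P *m D *m P) = f (invmx P) *m char_poly_mx D *m f P.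
  rewrite /char_poly_mx mulmxBr mulmxBl !map_mxM /= -/(f P).
  by rewrite scalar_mxC -[_%:M *m _ *m _]mulmxA fVP mulmx1.
rewrite !det_mulmx mulrAC -det_mulmx fVP det1 mul1r //.
Qed.

(** A matrix killed by a product of distinct linear factors is diagonalizable, and [m x] counts the
    diagonal entries equal to [x]. The trace formula turns traces of powers into linear equations
    for these multiplicities. *)
Lemma char_poly_annihilated (F : fieldType) (n : nat) (A : 'M[F]_n.+1) (rs : seq F) :
  uniq rs -> horner_mx A (\prod_(x <- rs) ('X - x%:P)) = 0 ->
  exists m : F -> nat,
    char_poly A = \prod_(x <- rs) ('X - x%:P) ^+ m x /\
    forall p : {poly F}, \tr (horner_mx A p) = \sum_(x <- rs) p.[x] *+ m x.
Proof.
move=> Urs Ars0.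
have dvd_rs : mxminpoly A %| \prod_(x <- rs) ('X - x%:P).
  exact: mxminpoly_min.
have [|P Pu /mxpoly.diagonalizable_forPex[d /(mxpoly.simmxLR Pu)]] :=
    (mxpoly.diagonalizableP A).2.
  by exists rs.
rewrite mxpoly.conjVmx // => dA.
have hA p : horner_mx A p = invmx P *m diag_mx (map_mx (horner p) d) *m P.
  by rewrite dA mxpoly.horner_mx_uconjC // horner_mx_diag.
have d_rs i : d 0 i \in rs.
  rewrite -root_prod_XsubC.
  have := hA (\prod_(x <- rs) ('X - x%:P)); rewrite Ars0.
  move/(congr1 (fun B => P *m B *m invmx P)).
  rewrite mulmx0 mul0mx !mulmxA mulmxV // mul1mx mulmxK //.
  by move/matrixP/(_ i i); rewrite !mxE eqxx mulr1n => /esym/eqP.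
exists (fun x => #|[set i | d 0 i == x]|); split.
  have -> : char_poly A = char_poly (diag_mx d).
    by rewrite dA char_poly_conj.
  rewrite char_poly_trig ?diag_mx_is_trig //.
  (* Only one factor of the inner product differs from 1; exchanging the products groups equal
     diagonal entries. *)
  transitivity (\prod_i \prod_(x <- rs) (if d 0 i == x then 'X - x%:P else 1)).
    apply: eq_bigr => i _; rewrite mxE eqxx mulr1n.
    rewrite (bigD1_seq (d 0 i)) //= eqxx big1 ?mulr1 // => x /negPf.
    by rewrite eq_sym => ->.
  rewrite exchange_big; apply: eq_bigr => x _ /=.
  rewrite -big_mkcond /= -prodr_const.
  by apply: eq_bigl => i; rewrite inE.
move=> p; rewrite hA mxtrace_mulC mulmxA mulmxV // mul1mx mxtrace_diag.
transitivity (\sum_i \sum_(x <- rs) (if d 0 i == x then p.[x] else 0)).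
  apply: eq_bigr => i _; rewrite mxE.
  rewrite (bigD1_seq (d 0 i)) //= eqxx big1 ?addr0 // => x /negPf.
  by rewrite eq_sym => ->.
rewrite exchange_big; apply: eq_bigr => x _ /=.
rewrite -big_mkcond /= -sumr_const.
by apply: eq_bigl => i; rewrite inE.
Qed.

(** * Graphs satisfying the tangent equation *)

Definition adjQ (n : nat) (e : rel 'I_n) : 'M[rat]_n := \matrix_(i, j) (e i j)%:R.

Lemma adjQ_sqr (n : nat) (e : rel 'I_n) (i j : 'I_n) : symmetric e ->
  (adjQ e *m adjQ e) i j = (common_nbrs e i j)%:R.
Proof.
move=> esym; rewrite mxE /common_nbrs -sum1_card natr_sum [in RHS]big_mkcond /=.
apply: eq_bigr => z _; rewrite !mxE inE (esym z j).
by case: (e i z); case: (e j z); rewrite ?mulr0 ?mul0r ?mulr1.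
Qed.

Lemma common_nbrs_diag (T : finType) (e : rel T) (x : T) :
  common_nbrs e x x = #|[set y | e x y]|.
Proof. by apply: eq_card => y; rewrite !inE andbb. Qed.

Lemma regular_nontrivial (n : nat) (e : rel 'I_n) (k : nat) :
  irreflexive e -> regular e k -> (0 < k)%N -> (k.+1 < n)%N ->
  ~ is_complete e /\ ~ is_edgeless e.
Proof.
move=> eirr reg k0 kn.
have x0 : 'I_n by apply: (@Ordinal n 0); lia.
split=> [ecomp|eless]; have := reg x0.
  have -> : [set y | e x0 y] = [set~ x0].
    apply/setP => y; rewrite !inE; have [->|yx] := eqVneq y x0; first by rewrite eirr.
    by rewrite ecomp // eq_sym.
  by rewrite cardsC1 card_ord; lia.
rewrite (_ : [set y | e x0 y] = set0) ?cards0; first by lia.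
by apply/setP => y; rewrite !inE (negPf (eless _ _)).
Qed.

Lemma srg_of_common_nbrs (n : nat) (e : rel 'I_n) (k l m : nat) :
  symmetric e -> irreflexive e -> (0 < k)%N -> (k.+1 < n)%N ->
  (forall i j, common_nbrs e i j = if i == j then k else if e i j then l else m) ->
  srg e n k l m.
Proof.
move=> esym eirr k0 kn cnE.
have reg x : #|[set y | e x y]| = k by rewrite -common_nbrs_diag cnE eqxx.
have [ncomp nless] := regular_nontrivial eirr reg k0 kn.
do ![split] => //.
- by rewrite card_ord.
- by move=> x y exy; rewrite cnE exy; case: eqP exy => // ->; rewrite eirr.
- by move=> x y /negPf xy /negPf exy; rewrite cnE xy exy.
Qed.

Lemma adjQ_sqr_srg (n : nat) (e : rel 'I_n) (k l m : nat) :
  symmetric e -> irreflexive e -> (0 < k)%N -> (k.+1 < n)%N ->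
  adjQ e *m adjQ e
    = k%:R%:M + l%:R *: adjQ e + m%:R *: (const_mx 1 - 1%:M - adjQ e) ->
  srg e n k l m.
Proof.
move=> esym eirr k0 kn sqE; apply: srg_of_common_nbrs => // i j.
apply/eqP; rewrite -(eqr_nat rat) -adjQ_sqr // sqE !mxE.
have [->|ij] := eqVneq i j; first by rewrite eirr /=; apply/eqP; ring.
by case: (e i j) => /=; apply/eqP; ring.
Qed.

(** The bound is strict because [s * (s - 1)] and [s] coincide at [s = 2]. *)
Lemma uniq_unital_eigenvalues (s : rat) : 2 < s -> uniq [:: s * (s - 1); s; -1; - s].
Proof.
move=> s2; rewrite /= !inE !negb_or !andbT.
by do ![apply/andP; split]; apply/negP => /eqP; nra.
Qed.

(** Power sums of orders 0 to 3 determine the weights of four distinct values. The values of [b] and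
    [d] are given doubled and without negative terms, so that they can be read in the naturals. *)
Lemma unital_multiplicities (s a b c d : rat) :
  2 < s -> let k := s * (s - 1) in let n := s ^+ 2 * (s ^+ 2 - s + 1) in
  a + b + c + d = n -> k * a + s * b - c - s * d = 0 ->
  k ^+ 2 * a + s ^+ 2 * b + c + s ^+ 2 * d = n * k ->
  k ^+ 3 * a + s ^+ 3 * b - c - s ^+ 3 * d = n * k ->
  [/\ a = 1, 2 * b + 2 * s ^+ 3 + s = s ^+ 4 + 2 * s ^+ 2, c = s ^+ 3
    & 2 * d + 2 * s ^+ 3 + 2 = s ^+ 4 + s].
Proof.
move=> s2 k n E0 E1 E2 E3; have s0 : 0 < s by lra.
have a1 : a = 1.
  (* Weighting by [(x + 1) * (x ^+ 2 - s ^+ 2)] removes the eigenvalues [s], [-1] and [- s]; this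
     factor is its value at [k]. *)
  have f0 : (k + 1) * s ^+ 3 * (s - 2) != 0.
    by rewrite gt_eqF // !mulr_gt0 ?exprn_gt0 ?subr_gt0 // /k; nra.
  apply/eqP; rewrite -subr_eq0 -(mulrI_eq0 _ (mulfI f0)); apply/eqP.
  transitivity (k ^+ 3 * a + s ^+ 3 * b - c - s ^+ 3 * d - n * k
    + (k ^+ 2 * a + s ^+ 2 * b + c + s ^+ 2 * d - n * k)
    - s ^+ 2 * (k * a + s * b - c - s * d) - s ^+ 2 * (a + b + c + d - n)).
    by rewrite /n /k; ring.
  by rewrite E3 E2 E1 E0; ring.
subst a.
have cE : c = s ^+ 3.
  (* With [a] known, weighting by [s ^+ 2 - x ^+ 2] removes [s] and [- s] and isolates [c]. *)
  have f0 : s ^+ 2 - 1 != 0 by rewrite gt_eqF //; nra.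
  apply/eqP; rewrite -subr_eq0 -(mulrI_eq0 _ (mulfI f0)); apply/eqP.
  transitivity (s ^+ 2 * (1 + b + c + d - n)
    - (k ^+ 2 * 1 + s ^+ 2 * b + c + s ^+ 2 * d - n * k)).
    by rewrite /n /k; ring.
  by rewrite E0 E2; ring.
subst c.
have bd : b - d = s ^+ 2 - s + 1.
  have f0 : s != 0 by rewrite gt_eqF //; lra.
  by apply: (mulfI f0); move: E1; rewrite /k; lra.
by move: E0; rewrite /n; split=> //; lra.
Qed.

Section UnitalGraph.
Variables (q n : nat) (e : rel 'I_n.+1).
Hypothesis q_gt2 : (2 < q)%N.
Hypothesis e_sym : symmetric e.
Hypothesis e_irr : irreflexive e.
Hypothesis e_reg : regular e (q * (q - 1)).
Hypothesis e_common : forall x y, x != y -> (common_nbrs e x y <= 1)%N.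
(* [q.+1 * (z == y) + childA e 1 0 z y] is the number of isotropic points
   orthogonal to both [z] and [y]. *)
Hypothesis e_tangent : forall x y,
  (\sum_(z | (z == x) || e x z) (q.+1 * (z == y) + childA e 1 0 z y))%N = q.+1.

Let A := adjQ e.
Let B := adjQ (childB e 1 0).
Let C := adjQ (childA e 1 0).
Let J : 'M[rat]_n.+1 := const_mx 1.
Let s : rat := q%:R.
Let k : rat := s * (s - 1).

Let kE : (q * (q - 1))%N%:R = k.
Proof. by rewrite natrM natrB //; lia. Qed.

Let scE (a : rat) : a%:M = a *: 1 :> 'M[rat]_n.+1.
Proof. by rewrite scalemx1. Qed.

Lemma child_sym : symmetric (childA e 1 0) /\ symmetric (childB e 1 0).
Proof.
have cnC x y : common_nbrs e x y = common_nbrs e y x.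
  by apply: eq_card => z; rewrite !inE andbC.
by split=> x y; rewrite /childA /childB /= eq_sym cnC.
Qed.

Lemma child_irr : irreflexive (childA e 1 0) /\ irreflexive (childB e 1 0).
Proof. by split=> x; rewrite /childA /childB /= eqxx. Qed.

Lemma childBE : B = J - 1%:M - C.
Proof.
apply/matrixP => i j; rewrite !mxE /childA /childB /=.
have [->|ij] := eqVneq i j; first by rewrite /=; ring.
by have := e_common ij; case: (common_nbrs e i j) => [|[|]] //= _; ring.
Qed.

(** By [e_common], [A * A] is a 0-1 matrix off the diagonal and [C] is its complement there; the
    scalar matrix corrects the diagonal. *)
Lemma childAE : C = (k - 1)%:M + J - A * A.
Proof.
apply/matrixP => i j; rewrite !mxE -/A.
have -> : \sum_j0 A i j0 * A j0 j = (A *m A) i j by rewrite mxE.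
rewrite adjQ_sqr // /childA /=; have [->|ij] := eqVneq i j.
  by rewrite common_nbrs_diag e_reg kE /=; ring.
by have := e_common ij; case: (common_nbrs e i j) => [|[|]] //= _; ring.
Qed.

Lemma mulAJ : A * J = k *: J.
Proof.
apply/matrixP => i j; rewrite !mxE -kE -(e_reg i) -sum1_card natr_sum mulr1.
rewrite [in RHS]big_mkcond /=.
by apply: eq_bigr => z _; rewrite !mxE inE; case: (e i z); rewrite mulr1.
Qed.

Lemma mulJJ : J * J = n.+1%:R *: J.
Proof.
apply/matrixP => i j; rewrite !mxE mulr1.
under eq_bigr => z _ do rewrite !mxE mulr1.
by rewrite sumr_const card_ord.
Qed.

Lemma mulJA : J * A = k *: J.
Proof.
have trA : A^T = A by apply/matrixP => i j; rewrite !mxE e_sym.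
have trJ : J^T = J by apply/matrixP => i j; rewrite !mxE.
by rewrite -[LHS]trmxK trmx_mul trA trJ [_ *m _]mulAJ linearZ /= trJ.
Qed.

(** This is [e_tangent] in matrix form: summing over closed neighbourhoods is multiplication by
    [1 + A]. *)
Lemma tangent_mx : (1 + A) * ((s + 1)%:M + C) = (s + 1) *: J.
Proof.
apply/matrixP => i j; rewrite !mxE.
transitivity ((\sum_(z | (z == i) || e i z)
    (q.+1 * (z == j) + childA e 1 0 z j))%N%:R : rat).
  rewrite natr_sum [in RHS]big_mkcond; apply: eq_bigr => z _ /=.
  rewrite !mxE natrD natrM -(addn1 q) natrD.
  rewrite -[(s + 1) *+ _]mulr_natr (eq_sym i) /s.
  have [->|_] := eqVneq z i; first by rewrite e_irr /=; ring.
  by case: (e i z); rewrite /=; ring.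
by rewrite e_tangent -(addn1 q) natrD mulr1.
Qed.

(** Eliminating [C] from [tangent_mx] by [childAE] leaves an equation in [A] and [J], where [s ^+ 2]
    arises as [s + k]. *)
Lemma cubic : A * A * A = (s ^+ 2)%:M + s ^+ 2 *: A - A * A + (k - s) *: J.
Proof.
have := tangent_mx; rewrite childAE mulrDl mul1r !(mulrDr, mulrN) mulAJ mulrA.
rewrite !scE -!scalerAr !mulr1 => H.
apply/matrixP => i j; move/matrixP/(_ i j): H.
rewrite !mxE /k; set a2 := \sum_j0 A i j0 * A j0 j.
set a3 := \sum_j0 (A * A) i j0 * A j0 j => H.
by apply/eqP; rewrite -subr_eq0 -(subrr ((s + 1) * 1)) -{2}H; apply/eqP; ring.
Qed.

(** Multiplying [cubic] by [A] and reducing once more cancels the odd powers. Hence the span of [1],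
    [J] and [A * A], which contains [B] and [C], is closed under products; this makes both children
    strongly regular. *)
Lemma quartic :
  A * A * A * A
    = (s ^+ 2 + 1) *: (A * A) - (s ^+ 2)%:M + ((k - s) * (k - 1)) *: J.
Proof.
rewrite {1}cubic !mulrDl mulNr cubic -!scalerAl mulJA.
rewrite !scE -!scalerAl mul1r.
by apply/matrixP => i j; rewrite !mxE; ring.
Qed.

Let s2 : 2 < s. Proof. by rewrite /s ltr_nat. Qed.

(** Since [A] acts on [J] as the scalar [k], multiplying [cubic] by [J] gives a numerical equation.
    It determines the order because the coefficient [k - s], that is [s * (s - 2)], is nonzero. *)
Lemma unital_card : n.+1 = (q ^ 2 * (q ^ 2 - q + 1))%N.
Proof.
have := cubic; move/(congr1 (fun M => M * J)).
rewrite !scE !mulrDl mulNr -!scalerAl -!mulrA !mulAJ -!scalerAr !mulAJ.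
rewrite -!scalerAr !mulAJ mul1r mulJJ => /matrixP/(_ 0 0); rewrite !mxE => H.
apply/eqP; rewrite -(eqr_nat rat) natrM natrD natrB; last by nia.
rewrite natrX -/s.
have c0 : s * (s - 2) != 0.
  by apply: lt0r_neq0; apply: mulr_gt0; rewrite ?subr_gt0 // (lt_trans _ s2).
apply/eqP; apply: (mulfI c0).
apply/eqP; rewrite -subr_eq0 -(subrr (k * (k * (k * 1)))) {1}H /k.
apply/eqP; ring.
Qed.

Let nE : n.+1%:R = s ^+ 2 * (s ^+ 2 - s + 1).
Proof. by rewrite unital_card natrM natrD natrB ?natrX //; nia. Qed.

Lemma childA_sqr :
  C * C = ((s - 1) * (s + 1) ^+ 2)%:M + (2 * s ^+ 2 - 2) *: C
          + (s + 1) ^+ 2 *: (J - 1%:M - C).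
Proof.
rewrite childAE; rewrite !(mulrDl, mulrDr, mulrN, mulNr).
rewrite !scE -!(scalerAl, scalerAr) !(mul1r, mulr1) mulJJ nE.
rewrite !mulrA quartic mulJA -!scalerAl mulJA -!mulrA !mulAJ -!scalerAr !mulAJ.
by rewrite !scE; apply/matrixP => i j; rewrite !mxE /k; ring.
Qed.

Lemma childA_srg :
  srg (childA e 1 0) n.+1 ((q - 1) * (q + 1) ^ 2) (2 * q ^ 2 - 2) ((q + 1) ^ 2).
Proof.
have [Asym _] := child_sym; have [Airr _] := child_irr.
apply: adjQ_sqr_srg => //; first nia.
  rewrite unital_card; nia.
rewrite -/C -/J.
have -> : ((q - 1) * (q + 1) ^ 2)%N%:R = (s - 1) * (s + 1) ^+ 2.
  by rewrite natrM natrX natrD natrB //; lia.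
have -> : (2 * q ^ 2 - 2)%N%:R = 2 * s ^+ 2 - 2.
  by rewrite natrB ?natrM ?natrX //; nia.
by rewrite natrX natrD; exact: childA_sqr.
Qed.

(** As [B] is [A * A - k%:M], [quartic] expresses [B * B] through [A * A], [1] and [J]. The
    subtraction in the third parameter comes last so that it is not truncated. *)
Lemma childB_srg :
  srg (childB e 1 0) n.+1 (q * (q - 1) * (q ^ 2 - q - 1))
    (q ^ 4 + 4 * q + 1 - 3 * q ^ 3) (q * (q - 2) * (q ^ 2 - q - 1)).
Proof.
have [_ Bsym] := child_sym; have [_ Birr] := child_irr.
have q1 : (1 < q ^ 2 - q)%N by nia.
apply: adjQ_sqr_srg => //; first by rewrite !muln_gt0 !subn_gt0; lia.
  have -> : (q * (q - 1) = q ^ 2 - q)%N by nia.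
  rewrite unital_card.
  move: (q ^ 2 - q)%N (leq_subr q (q ^ 2)) q1 => p.
  by move: (q ^ 2)%N => r pr p1; nia.
rewrite -/B -/J.
have -> : (q * (q - 1) * (q ^ 2 - q - 1))%N%:R = k * (k - 1).
  by rewrite !natrM !natrB ?natrX /k /s //; first ring; nia.
have -> : (q ^ 4 + 4 * q + 1 - 3 * q ^ 3)%N%:R = s ^+ 4 + 4 * s + 1 - 3 * s ^+ 3.
  rewrite natrB; first by rewrite natrD [(_ + 4 * q)%N%:R]natrD !natrX; ring.
  rewrite (expnS q 3) -addnA.
  by rewrite (leq_trans _ (leq_addr _ _)) // leq_mul2r q_gt2 orbT.
have -> : (q * (q - 2) * (q ^ 2 - q - 1))%N%:R = s * (s - 2) * (k - 1).
  by rewrite !natrM !natrB ?natrX /k /s //; first ring; nia.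
rewrite [_ *m _](_ : _ = B * B) //.
have BE : B = A * A - k%:M.
  by rewrite childBE childAE; apply/matrixP => i j; rewrite !mxE; ring.
rewrite BE !(mulrDl, mulrDr, mulrN, mulNr) !scE -!(scalerAl, scalerAr) !(mul1r, mulr1).
rewrite !mulrA quartic !scE.
by apply/matrixP => i j; rewrite !mxE /k; ring.
Qed.

Lemma unital_strongly_deza : strongly_deza e n.+1 (q * (q - 1)) 1 0.
Proof.
have k0 : (0 < q * (q - 1))%N by nia.
have kn : ((q * (q - 1)).+1 < n.+1)%N by rewrite unital_card; nia.
have [ncomp nless] := regular_nontrivial e_irr e_reg k0 kn.
split; last by do 4!eexists; exact: childB_srg.
  do ![split] => //; first by rewrite card_ord.
  move=> x y xy; have := e_common xy.
  by case: common_nbrs => [|[|]] // _; [right|left].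
by do 4!eexists; exact: childA_srg.
Qed.

Lemma unital_char_poly :
  char_poly (adjmx e) =
    ('X - (q * (q - 1))%N%:R%:P) ^+ 1
    * ('X - q%:R%:P) ^+ ((q ^ 4 - q) %/ 2 + q ^ 2 - q ^ 3)%N
    * ('X - (-1)%:P) ^+ (q ^ 3)%N
    * ('X - (- q%:R)%:P) ^+ ((q ^ 4 - q) %/ 2 + q - 1 - q ^ 3)%N.
Proof.
pose rs := [:: k; s; -1; - s].
have Urs : uniq rs by exact: uniq_unital_eigenvalues.
have Ars0 : horner_mx A (\prod_(x <- rs) ('X - x%:P)) = 0.
  (* The second factor is [(X + 1) * (X ^ 2 - s ^ 2)] expanded; at [A] it equals [(k - s) *: J] by
     [cubic], and [A - k%:M] kills [J]. *)
  have -> : \prod_(x <- rs) ('X - x%:P) =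
      ('X - k%:P) * ('X * 'X * 'X + 'X * 'X - (s ^+ 2)%:P * 'X - (s ^+ 2)%:P).
    by rewrite unlock /=; ring.
  rewrite rmorphM !rmorphB rmorphD !rmorphM /= !horner_mx_X !horner_mx_C cubic.
  rewrite [X in _ * X](_ : _ = (k - s) *: J); last first.
    rewrite !scE; do !rewrite -scalerAl ?mul1r.
    apply/matrixP => i j; rewrite !mxE; ring.
  by rewrite -scalerAr mulrBl mulAJ -mulrA ![_%:M * _]mul_scalar_mx scalerA subrr scaler0.
have [m [chi trE]] := char_poly_annihilated Urs Ars0.
have trA1 : \tr A = 0.
  by rewrite /mxtrace big1 // => i _; rewrite mxE e_irr.
have tr1 : \tr (1 : 'M[rat]_n.+1) = n.+1%:R by rewrite mxtrace1.
have trJ : \tr J = n.+1%:R.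
  by rewrite /mxtrace; under eq_bigr do rewrite mxE; rewrite sumr_const card_ord.
have trA2 : \tr (A * A) = n.+1%:R * k.
  rewrite /mxtrace; under eq_bigr => i _ do
    rewrite [(A * A) i i]adjQ_sqr // common_nbrs_diag e_reg kE.
  by rewrite sumr_const card_ord mulr_natl.
have trA3 : \tr (A * A * A) = n.+1%:R * k.
  rewrite cubic !mxtraceD linearN /= !mxtraceZ mxtrace_scalar trA1 trA2 trJ /k.
  by rewrite -mulr_natr; ring.
have trE4 p : \tr (horner_mx A p) = p.[k] * (m k)%:R + p.[s] * (m s)%:R
    + p.[-1] * (m (-1))%:R + p.[- s] * (m (- s))%:R.
  by rewrite trE /rs !big_cons big_nil !mulr_natr addr0 !addrA.
have m0 := trE4 1; rewrite rmorph1 tr1 nE !hornerE in m0.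
have m1 := trE4 'X; rewrite horner_mx_X trA1 !hornerE in m1.
have m2 := trE4 ('X * 'X).
rewrite rmorphM /= horner_mx_X trA2 nE !(hornerM, hornerX) in m2.
have m3 := trE4 ('X * 'X * 'X).
rewrite !rmorphM /= horner_mx_X trA3 nE !(hornerM, hornerX) in m3.
have [a1 b1 c1 d1] : [/\ (m k)%:R = 1 :> rat,
    2 * (m s)%:R + 2 * s ^+ 3 + s = s ^+ 4 + 2 * s ^+ 2, (m (-1))%:R = s ^+ 3
    & 2 * (m (- s))%:R + 2 * s ^+ 3 + 2 = s ^+ 4 + s].
  apply: unital_multiplicities s2 _ _ _ _.
  - by rewrite m0; ring.
  - by rewrite [RHS]m1 /k; ring.
  - by rewrite m2 /k; ring.
  - by rewrite m3 /k; ring.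
have mk : m k = 1%N by apply/eqP; rewrite -(eqr_nat rat) a1.
have m1E : m (-1) = (q ^ 3)%N by apply/eqP; rewrite -(eqr_nat rat) c1 natrX.
(* The doubled equation forces [q ^ 4 - q] to be even, and [q <= q ^ 4] keeps that difference
   exact. *)
have msE : m s = ((q ^ 4 - q) %/ 2 + q ^ 2 - q ^ 3)%N.
  have : (2 * m s + 2 * q ^ 3 + q = q ^ 4 + 2 * q ^ 2)%N.
    by apply/eqP; rewrite -(eqr_nat rat) !(natrD, natrM, natrX) -/s; apply/eqP; lra.
  have : (q <= q ^ 4)%N by rewrite -{1}(expn1 q) leq_pexp2l //; lia.
  by move: (q ^ 4)%N (q ^ 3)%N (q ^ 2)%N => x4 x3 x2; lia.
have mNsE : m (- s) = ((q ^ 4 - q) %/ 2 + q - 1 - q ^ 3)%N.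
  have : (2 * m (- s)%R + 2 * q ^ 3 + 2 = q ^ 4 + q)%N.
    by apply/eqP; rewrite -(eqr_nat rat) !(natrD, natrM, natrX) -/s; apply/eqP; lra.
  have : (q <= q ^ 4)%N by rewrite -{1}(expn1 q) leq_pexp2l //; lia.
  by move: (q ^ 4)%N (q ^ 3)%N => x4 x3; lia.
(* The integers embed in the rationals, so comparing the images of both polynomials suffices. *)
apply: (map_inj_poly (f := intr : int -> rat)); [exact: intr_inj | exact: rmorph0 |].
rewrite map_char_poly.
have -> : map_mx intr (adjmx e) = A.
  by apply/matrixP => i j; rewrite !mxE; case: (e i j).
have fac (z : int) l :
    map_poly (intr : int -> rat) (('X - z%:P) ^+ l) = ('X - (z%:~R)%:P) ^+ l.
  by rewrite rmorphXn rmorphB /= map_polyX map_polyC.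
rewrite chi /rs !big_cons big_nil mulr1 mk m1E msE mNsE.
rewrite !(rmorphM (map_poly (intr : int -> rat))) /= !fac !mulrA.
by rewrite -kE !(rmorphN (intr : int -> rat)) /= !(rmorph_nat (intr : int -> rat)).
Qed.
End UnitalGraph.

(** * Polarities with absolute points *)

Section UnitaryPolarity.
Local Open Scope nat_scope.
Variables (P : finType) (perp : rel P) (q n : nat) (f : 'I_n.+1 -> P).
Hypothesis perp_sym : symmetric perp.
Hypothesis perp_meet : forall x y, x != y ->
  exists w, forall z, perp x z && perp y z = (z == w).
Hypothesis perp_nonabs : forall x, ~~ perp x x ->
  #|[set z | perp x z & ~~ perp z z]| = q * (q - 1).
Hypothesis perp_abs : forall x, ~~ perp x x ->
  #|[set z | perp x z & perp z z]| = q.+1.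
Hypothesis f_inj : injective f.
Hypothesis f_nonabs : forall i, ~~ perp (f i) (f i).
Hypothesis f_surj : forall x, ~~ perp x x -> exists i, f i = x.

Definition polarity_graph : rel 'I_n.+1 := fun i j => perp (f i) (f j).
Local Notation e := polarity_graph.

Lemma card_nonabs (Q : pred P) : #|[set i | Q (f i)]| = #|[set z | Q z & ~~ perp z z]|.
Proof.
rewrite -(card_imset _ f_inj); apply: eq_card => z; rewrite inE.
apply/imsetP/andP => [[i]|[Qz /f_surj[i fi]]]; first by rewrite inE => Qi ->.
by exists i; rewrite ?inE fi.
Qed.

Lemma polarity_graph_irr : irreflexive e.
Proof. by move=> i; apply/negbTE/f_nonabs. Qed.

Lemma polarity_graph_regular : regular e (q * (q - 1)).
Proof.
move=> i; rewrite -(perp_nonabs (f_nonabs i)).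
exact: (card_nonabs (fun z => perp (f i) z)).
Qed.

Definition common_abs (x y : P) : nat :=
  #|[set z | perp x z && perp y z & perp z z]|.

(** The single point conjugate to both is either a vertex or absolute, so exactly one of the two
    terms counts it. *)
Lemma common_nbrs_abs (i j : 'I_n.+1) : i != j ->
  common_nbrs e i j + common_abs (f i) (f j) = 1.
Proof.
move=> ij; have [w wE] := perp_meet (contra_neq (@f_inj _ _) ij).
rewrite /common_nbrs (card_nonabs (fun z => perp (f i) z && perp (f j) z)).
rewrite -(cards1 w) -(cardsID [set z | perp z z] [set w]) addnC; congr (_ + _).
  by apply: eq_card => z; rewrite !inE wE.
by apply: eq_card => z; rewrite !inE wE andbC.
Qed.

Lemma polarity_graph_common (i j : 'I_n.+1) : i != j -> common_nbrs e i j <= 1.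
Proof. by move/common_nbrs_abs <-; rewrite leq_addr. Qed.

(* The point counted is the pole of the line joining [x] and [p], unless [p] is
   conjugate to [x]: then that pole is [p] itself and [x] takes its place. *)
Lemma closed_nbr_abs (x p : P) : ~~ perp x x -> perp p p ->
  #|[set z | ((z == x) || perp x z) && perp p z & ~~ perp z z]| = 1.
Proof.
move=> xx pp; have xp : x != p by apply: contraNneq xx => ->.
have [w wE] := perp_meet xp.
have [px|px] := boolP (perp p x).
  have wp : p = w by apply/eqP; rewrite -wE pp perp_sym px.
  rewrite -(cards1 x); apply: eq_card => z; rewrite !inE.
  have [->|zx] := eqVneq z x; first by rewrite px.
  by rewrite /= wE -wp; case: eqP => // ->; rewrite pp.
rewrite -(cards1 w); apply: eq_card => z; rewrite !inE.
have [->|zx] := eqVneq z x.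
  rewrite (negPf px) /=; apply/esym/negbTE; apply: contraNneq px => xw.
  by have := wE x; rewrite xw eqxx -xw (negPf xx).
rewrite /= wE; case: eqP => //= zw; subst z.
have /andP[xw pw] : perp x w && perp p w by rewrite wE.
apply/negP => ww; have wp : w != p by apply: contraNneq px => <-; rewrite perp_sym.
have [v vE] := perp_meet wp.
have := vE w; rewrite ww pw => /esym/eqP wv.
have := vE p; rewrite pp perp_sym pw => /esym/eqP pv.
by rewrite wv pv eqxx in wp.
Qed.

(** Double counting of pairs of a [z] in the closed neighbourhood of [i] and an absolute [p]
    conjugate to both [z] and [j]: there are [q.+1] choices of [p], and [closed_nbr_abs] leaves one
    [z] for each. *)
Lemma polarity_graph_tangent (i j : 'I_n.+1) :
  \sum_(z | (z == i) || e i z) (q.+1 * (z == j) + childA e 1 0 z j) = q.+1.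
Proof.
transitivity (\sum_(z | (z == i) || e i z) common_abs (f z) (f j)).
  (* For [z = j] all absolute points conjugate to [j] count; otherwise [common_nbrs_abs] makes
     [childA] indicate the common absolute point. *)
  apply: eq_bigr => z _; rewrite /childA /=; have [->|zj] := eqVneq z j.
    rewrite muln1 addn0 -(perp_abs (f_nonabs j)).
    by apply: eq_card => p; rewrite !inE andbb.
  have := common_nbrs_abs zj; case: (common_nbrs e z j) => [|[|]] //=; rewrite muln0; lia.
transitivity (\sum_(p | perp (f j) p && perp p p)
    #|[set z | ((f z == f i) || perp (f i) (f z)) && perp p (f z)]|).
  rewrite /common_abs; under eq_bigr do rewrite -sum1_card.
  rewrite (exchange_big_dep (fun p => perp (f j) p && perp p p)) /=; last first.
    by move=> z p _; rewrite inE => /andP[/andP[_ ->] ->].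
  apply: eq_bigr => p /andP[jp pp]; rewrite -sum1_card; apply: eq_bigl => z.
  by rewrite !inE (inj_eq f_inj) jp pp !andbT perp_sym.
rewrite -(perp_abs (f_nonabs j)) -sum1_card.
apply: eq_big => [p|p /andP[_ pp]]; first by rewrite inE.
rewrite (card_nonabs (fun z => ((z == f i) || perp (f i) z) && perp p z)).
exact: closed_nbr_abs.
Qed.
End UnitaryPolarity.

(** * The Hermitian plane *)

Section HermitianPlane.
Variables (F : finFieldType) (conj : {rmorphism F -> F}) (q : nat).
Hypothesis conjK : involutive conj.
Hypothesis card_F : #|F| = (q ^ 2)%N.
Hypothesis card_norm : forall c : F, c != 0 -> conj c = c ->
  #|[set x | x * conj x == c]| = q.+1.
Hypothesis trace_neq0 : exists r : F, r + conj r != 0.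

Local Notation vec := (F * F * F)%type.
Implicit Types (u v w z : vec) (a b c : F).

Definition herm u v : F :=
  u.1.1 * conj v.1.1 + u.1.2 * conj v.1.2 + u.2 * conj v.2.

(** The usual cross product is conjugated so as to be orthogonal to both arguments for the Hermitian
    form. *)
Definition cross u v : vec :=
  (conj (u.1.2 * v.2 - u.2 * v.1.2), conj (u.2 * v.1.1 - u.1.1 * v.2),
   conj (u.1.1 * v.1.2 - u.1.2 * v.1.1)).

Definition scalev c v : vec := (c * v.1.1, c * v.1.2, c * v.2).

Definition normed v : bool :=
  (v.1.1 == 1) || (v.1.1 == 0) && ((v.1.2 == 1) || (v.1.2 == 0) && (v.2 == 1)).

(** Linear dependence as vanishing of the minors; the zero vector is parallel to every vector. *)
Definition parallel u v : Prop :=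
  [/\ u.1.1 * v.1.2 = u.1.2 * v.1.1, u.1.2 * v.2 = u.2 * v.1.2
    & u.2 * v.1.1 = u.1.1 * v.2].

Lemma herm_conj u v : conj (herm u v) = herm v u.
Proof. by rewrite /herm !(rmorphD, rmorphM) !conjK; ring. Qed.

Lemma herm_eq0C u v : (herm u v == 0) = (herm v u == 0).
Proof. by rewrite -(inj_eq (can_inj conjK)) herm_conj rmorph0. Qed.

Lemma hermZl c u v : herm (scalev c u) v = c * herm u v.
Proof. by rewrite /herm /=; ring. Qed.

Lemma hermZr c u v : herm u (scalev c v) = conj c * herm u v.
Proof. by rewrite /herm /=; ring. Qed.

Lemma herm_crossl u v : herm u (cross u v) = 0.
Proof. by rewrite /herm /cross /= !conjK; ring. Qed.

Lemma herm_crossr u v : herm v (cross u v) = 0.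
Proof. by rewrite /herm /cross /= !conjK; ring. Qed.

(** Lagrange's identity: the right side is the Gram determinant of [u] and [v]. *)
Lemma herm_cross u v :
  herm (cross u v) (cross u v) = herm u u * herm v v - herm u v * herm v u.
Proof. by rewrite /herm /cross /= !conjK; ring. Qed.

(** After conjugation each minor is a combination of the two orthogonality equations, as in the
    expansion of a triple cross product. *)
Lemma parallel_cross u v z : herm u z = 0 -> herm v z = 0 -> parallel z (cross u v).
Proof.
rewrite /herm => Hu Hv; split; apply: (can_inj conjK); rewrite !rmorphM /= !conjK;
  apply/eqP; rewrite -subr_eq0; apply/eqP.
- transitivity (u.2 * 0 - v.2 * 0); last by ring.
  by rewrite -{1}Hv -Hu; ring.
- transitivity (u.1.1 * 0 - v.1.1 * 0); last by ring.
  by rewrite -{1}Hv -Hu; ring.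
- transitivity (u.1.2 * 0 - v.1.2 * 0); last by ring.
  by rewrite -{1}Hv -Hu; ring.
Qed.

Lemma parallel_normed z v : normed z -> parallel z v -> exists c, v = scalev c z.
Proof.
case: z v => [[z1 z2] z3] [[v1 v2] v3]; rewrite /normed /parallel /scalev /=.
case/orP => [/eqP->|/andP[/eqP-> /orP[/eqP->|/andP[/eqP-> /eqP->]]]] [H1 H2 H3].
- exists v1; rewrite mulr1; congr (_, _, _); first by rewrite -[LHS]mul1r H1; ring.
  by rewrite -[LHS]mul1r -H3; ring.
- exists v2; rewrite mulr1; congr (_, _, _); first by rewrite -[LHS]mul1r -H1; ring.
  by rewrite -[LHS]mul1r H2; ring.
- exists v3; rewrite mulr1; congr (_, _, _); first by rewrite -[LHS]mul1r H3; ring.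
  by rewrite -[LHS]mul1r -H2; ring.
Qed.

Lemma normed_scale c z : normed z -> normed (scalev c z) -> c = 1.
Proof.
case: z => [[z1 z2] z3]; rewrite /normed /scalev /=.
case/orP => [/eqP->|/andP[/eqP-> /orP[/eqP->|/andP[/eqP-> /eqP->]]]];
  rewrite ?mulr1 ?mulr0 ?eqxx ?[0 == 1]eq_sym ?oner_eq0 /=.
- by case/orP => [/eqP//|/andP[/eqP->]]; rewrite !mul0r ![0 == 1]eq_sym oner_eq0 andbF.
- by case/orP => [/eqP//|/andP[/eqP->]]; rewrite !mul0r ![0 == 1]eq_sym oner_eq0.
- by move/eqP.
Qed.

Lemma parallel_normed_eq z v : normed z -> normed v -> parallel z v -> z = v.
Proof.
move=> nz nv /(parallel_normed nz)[c vE]; rewrite vE in nv.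
by rewrite vE (normed_scale nz nv) /scalev !mul1r; case: z {nz nv vE} => [[]].
Qed.

Lemma parallel_scaler c z v : c != 0 -> parallel z (scalev c v) -> parallel z v.
Proof.
move=> c0 [/= H1 H2 H3]; split; apply: (mulfI c0).
- by rewrite mulrCA H1; ring.
- by rewrite mulrCA H2; ring.
- by rewrite mulrCA H3; ring.
Qed.

Lemma cross_eq0 u v : cross u v = 0 -> parallel u v.
Proof.
case=> /eqP h1 /eqP h2 /eqP h3; split; apply/eqP; rewrite -subr_eq0.
- by rewrite -(inj_eq (can_inj conjK)) rmorph0.
- by rewrite -(inj_eq (can_inj conjK)) rmorph0.
- by rewrite -(inj_eq (can_inj conjK)) rmorph0.
Qed.

Lemma normalize v : v != 0 -> exists c z, [/\ c != 0, normed z & v = scalev c z].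
Proof.
case: v => [[v1 v2] v3] v0; rewrite /normed /scalev.
have [v10|v10] := eqVneq v1 0; last first.
  exists v1, (1, v2 / v1, v3 / v1); split=> //=; first by rewrite eqxx.
  by rewrite mulr1 ![v1 * _]mulrC !divfK.
have [v20|v20] := eqVneq v2 0; last first.
  exists v2, (0, 1, v3 / v2); split=> //=; first by rewrite !eqxx orbT.
  by rewrite mulr1 mulr0 v10 mulrC divfK.
have [v30|v30] := eqVneq v3 0; first by rewrite v10 v20 v30 eqxx in v0.
exists v3, (0, 0, 1); split=> //=; first by rewrite !eqxx !orbT.
by rewrite mulr1 mulr0 v10 v20.
Qed.

Lemma scalev_eq0 c v : c != 0 -> scalev c v = 0 -> v = 0.
Proof.
case: v => [[v1 v2] v3] c0 [] /eqP h1 /eqP h2 /eqP h3; move: h1 h2 h3.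
by rewrite !mulf_eq0 (negPf c0) => /eqP-> /eqP-> /eqP->.
Qed.

(* Every one-dimensional subspace contains exactly one normed vector. *)
Definition point := {v : vec | normed v}.
Definition perp : rel point := fun x y => herm (val x) (val y) == 0.

Lemma perp_sym : symmetric perp.
Proof. by move=> x y; rewrite /perp herm_eq0C. Qed.

(** The pole of the line through [x] and [y] is their cross product, normalized; it is nonzero since
    distinct normed vectors are not parallel. *)
Lemma perp_meet (x y : point) : x != y ->
  exists w : point, forall z : point, perp x z && perp y z = (z == w).
Proof.
move=> xy; have : cross (val x) (val y) != 0.
  apply: contraNneq xy => /cross_eq0 par; apply/eqP/val_inj.
  exact: parallel_normed_eq (valP x) (valP y) par.
case/normalize => c [w [c0 nw wE]]; exists (exist _ w nw : point) => z.
have zw (h : vec) : herm h (cross (val x) (val y)) = 0 -> herm h w == 0.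
  move/eqP; rewrite wE hermZr mulf_eq0 => /orP[/eqP cc|//].
  by rewrite -[c]conjK cc rmorph0 eqxx in c0.
rewrite /perp; apply/andP/eqP => [[/eqP xz /eqP yz]|->]; last first.
  by split; apply: zw; [exact: herm_crossl | exact: herm_crossr].
apply: val_inj; apply: parallel_normed_eq (valP z) nw _.
by apply: parallel_scaler c0 _; rewrite -wE; exact: parallel_cross.
Qed.

(** Every nonzero vector is uniquely a nonzero scalar times a normed vector, which converts counts
    of vectors into counts of points. *)
Lemma card_homogeneous (Q : pred vec) :
  (forall c v, c != 0 -> Q (scalev c v) = Q v) ->
  #|[set v | Q v & v != 0]| = ((q ^ 2).-1 * #|[set x : point | Q (val x)]|)%N.
Proof.
move=> Qhom; rewrite -card_F.
have -> : #|F|.-1 = #|[set~ 0 : F]| by rewrite cardsC1.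
rewrite -cardsX; pose g (t : F * point) := scalev t.1 (val t.2).
rewrite -(card_in_imset (f := g)).
  apply: eq_card => v; rewrite inE; apply/andP/imsetP.
    case=> Qv /normalize[c [z [c0 nz vE]]]; exists (c, exist _ z nz : point) => //.
    by rewrite !inE c0 /= -(Qhom c) // -vE.
  case=> -[c x]; rewrite !inE /g /= => /andP[c0 Qx] ->; rewrite Qhom //; split=> //.
  apply/eqP => /(scalev_eq0 c0) x0; have : normed (sval x) by exact: valP.
  by rewrite x0 /normed /= eqxx eq_sym oner_eq0.
move=> [c x] [d y]; rewrite !inE /g /= => /andP[c0 _] /andP[d0 _] cd.
have xy : x = y.
  apply: val_inj; apply: parallel_normed_eq (valP x) (valP y) _.
  by apply: parallel_scaler d0 _; rewrite -cd; split=> /=; ring.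
subst y; congr (_, _).
have := @normed_scale (d^-1 * c) (val x) (valP x).
have -> : scalev (d^-1 * c) (val x) = val x.
  case: cd => e1 e2 e3; rewrite /scalev -!mulrA.
  by rewrite e1 e2 e3 !mulKf //; case: x {e1 e2 e3} => [[[]]].
by move=> /(_ (valP x)) dc1; rewrite -[c](mulKf d0) mulrCA dc1 mulr1.
Qed.

(** If the first coordinate is 0, so is the second. Each nonzero first coordinate prescribes a
    nonzero norm fixed by [conj] for the second, which [q.+1] elements attain. *)
Lemma card_binary_isotropic (g h : F) : g != 0 -> h != 0 -> conj g = g -> conj h = h ->
  #|[set t : F * F | t.1 * conj t.1 * g + t.2 * conj t.2 * h == 0]|
    = ((q ^ 2).-1 * q.+1).+1.
Proof.
move=> g0 h0 cg ch; rewrite -sum1_card.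
rewrite (eq_bigl (fun t : F * F =>
  xpredT t.1 && (t.1 * conj t.1 * g + t.2 * conj t.2 * h == 0))); last first.
  by move=> t; rewrite inE.
rewrite -(pair_big_dep xpredT
  (fun a b => a * conj a * g + b * conj b * h == 0) (fun _ _ => 1%N)) /=.
rewrite (bigD1 0) //= (big_pred1 0) => [|b]; last first.
  by rewrite !mul0r add0r !mulf_eq0 fmorph_eq0 (negPf h0) orbF orbb.
rewrite -add1n; congr (_ + _)%N.
rewrite (eq_bigr (fun=> q.+1)) => [|a a0].
  by rewrite sum_nat_const -card_F -(cardC1 (0 : F)).
have ca : conj a != 0 by rewrite fmorph_eq0.
pose c := - (a * conj a * g / h).
rewrite sum1_card -(@card_norm c).
- apply: eq_card => b; rewrite !inE.
  transitivity (a * conj a * g + b * conj b * h == 0); first by [].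
  by rewrite addrC addr_eq0 -(inj_eq (mulIf h0) (b * conj b)) /c mulNr divfK.
- by rewrite oppr_eq0 !mulf_neq0 // invr_neq0.
- by rewrite /c rmorphN fmorph_div !rmorphM conjK cg ch [conj a * a]mulrC.
Qed.

(** By [herm_cross] it suffices to find [v] whose Gram determinant with [x] is nonzero. One of the
    first two basis vectors serves unless the first two coordinates of [x] both have norm
    [herm x x]. *)
Lemma conjugate_nonisotropic (x : vec) : herm x x != 0 ->
  exists2 u, herm x u = 0 & herm u u != 0.
Proof.
move=> x0.
suff [v v0] : exists v, herm x x * herm v v - herm x v * herm v x != 0.
  by exists (cross x v); rewrite ?herm_crossl // herm_cross.
have [x1|x1] := eqVneq (herm x x) (x.1.1 * conj x.1.1); last first.
  exists (1, 0, 0); rewrite (_ : _ - _ = herm x x - x.1.1 * conj x.1.1) ?subr_eq0 //.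
  by rewrite {2 3 4}/herm /=; ring.
have [x2|x2] := eqVneq (herm x x) (x.1.2 * conj x.1.2); last first.
  exists (0, 1, 0); rewrite (_ : _ - _ = herm x x - x.1.2 * conj x.1.2) ?subr_eq0 //.
  by rewrite {2 3 4}/herm /=; ring.
(* With [N x1 = N x2 = herm x x], take [v] such that [herm x v = x1 * (1 + r)]. *)
have [r r0] := trace_neq0.
have x20 : x.1.2 != 0 by apply: contraNneq x0 => x20; rewrite x2 x20 mul0r.
have cx20 : conj x.1.2 != 0 by rewrite fmorph_eq0.
pose t := r * x.1.1 / x.1.2.
have xx : x.1.1 * conj x.1.1 = x.1.2 * conj x.1.2 by rewrite -x1.
have Nt : t * conj t = r * conj r.
  rewrite /t fmorph_div rmorphM.
  transitivity (r * conj r * (x.1.1 * conj x.1.1) / (x.1.2 * conj x.1.2)).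
    by field; apply/andP.
  by rewrite xx mulfK // mulf_neq0.
have xt : x.1.2 * t = r * x.1.1 by rewrite mulrC divfK.
exists (1, conj t, 0).
rewrite (_ : _ - _ = - (herm x x * (r + conj r))) ?oppr_eq0 ?mulf_neq0 //.
have hxv : herm x (1, conj t, 0) = x.1.1 * (1 + r).
  by rewrite /herm /= conjK xt rmorph1 rmorph0; ring.
rewrite -(herm_conj x (1, conj t, 0)) hxv rmorphM rmorphD x1 /herm /=.
by rewrite conjK (mulrC (conj t)) Nt rmorph1 rmorph0; ring.
Qed.

(** The vectors [u] and [cross x u] form an orthogonal basis of the complement of [x], in which the
    form becomes a diagonal binary one. *)
Lemma card_conjugate (x : vec) : herm x x != 0 ->
  #|[set v | herm x v == 0]| = (q ^ 4)%N /\
  #|[set v | herm x v == 0 & herm v v == 0]| = ((q ^ 2).-1 * q.+1).+1.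
Proof.
move=> x0.
have [u xu u0] := conjugate_nonisotropic x0.
pose w := cross x u.
have xw : herm x w = 0 := herm_crossl x u.
have uw : herm u w = 0 := herm_crossr x u.
have w0 : herm w w != 0 by rewrite herm_cross xu mul0r subr0 mulf_neq0.
pose f (t : F * F) : vec :=
  (t.1 * u.1.1 + t.2 * w.1.1, t.1 * u.1.2 + t.2 * w.1.2, t.1 * u.2 + t.2 * w.2).
have hf v t : herm (f t) v = t.1 * herm u v + t.2 * herm w v.
  by rewrite /f /herm /=; ring.
have wu : herm w u = 0 by rewrite -herm_conj uw rmorph0.
have ux : herm u x = 0 by rewrite -herm_conj xu rmorph0.
have wx : herm w x = 0 by rewrite -herm_conj xw rmorph0.
have f_inj : injective f.
  move=> s t st; have := congr1 (herm^~ u) st; have := congr1 (herm^~ w) st.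
  rewrite !hf uw wu !mulr0 !addr0 !add0r => /(mulIf w0) s2 /(mulIf u0) s1.
  by case: s t s1 s2 {st} => [s1 s2] [t1 t2] /= -> ->.
have fx t : herm x (f t) = 0 by rewrite -herm_conj hf ux wx !mulr0 addr0 rmorph0.
have hff t : herm (f t) (f t) = t.1 * conj t.1 * herm u u + t.2 * conj t.2 * herm w w.
  rewrite hf -(herm_conj (f t) u) -(herm_conj (f t) w) !hf uw wu !rmorphD !rmorphM.
  by rewrite !herm_conj rmorph0; ring.
have f_surj v : herm x v = 0 -> exists t, v = f t.
  (* [t] holds the orthogonal projection coefficients, so the residue [d] is orthogonal to [x], [u]
     and [w]. *)
  move=> xv; pose t := (herm v u / herm u u, herm v w / herm w w).
  pose d : vec := (v.1.1 - (f t).1.1, v.1.2 - (f t).1.2, v.2 - (f t).2).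
  have hd z : herm d z = herm v z - herm (f t) z by rewrite /herm /d /=; ring.
  have du : herm d u = 0 by rewrite hd hf wu mulr0 addr0 divfK // subrr.
  have dw : herm d w = 0 by rewrite hd hf uw mulr0 add0r divfK // subrr.
  have dx : herm d x = 0.
    by rewrite hd hf ux wx !mulr0 -herm_conj xv rmorph0 addr0 subrr.
  (* Orthogonality to [x] and [u] makes [d] parallel to [w]; being also orthogonal to the
     nonisotropic [w], it vanishes. *)
  have [] := @parallel_cross x u d; rewrite -/w.
  - by rewrite -herm_conj dx rmorph0.
  - by rewrite -herm_conj du rmorph0.
  move=> p12 p23 p31.
  have d0 (y : F) : y * herm w w = 0 -> y = 0.
    by move/eqP; rewrite mulf_eq0 (negPf w0) orbF => /eqP.
  exists t.
  have e1 : d.1.1 = 0.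
    apply: d0; transitivity (w.1.1 * herm d w); last by rewrite dw mulr0.
    rewrite /herm !mulrDr !mulrA (mulrC w.1.1 d.1.2) (mulrC w.1.1 d.2) -p12 p31; ring.
  have e2 : d.1.2 = 0.
    apply: d0; transitivity (w.1.2 * herm d w); last by rewrite dw mulr0.
    rewrite /herm !mulrDr !mulrA (mulrC w.1.2 d.1.1) (mulrC w.1.2 d.2) p12 -p23; ring.
  have e3 : d.2 = 0.
    apply: d0; transitivity (w.2 * herm d w); last by rewrite dw mulr0.
    rewrite /herm !mulrDr !mulrA (mulrC w.2 d.1.1) (mulrC w.2 d.1.2) -p31 p23; ring.
  rewrite [LHS](_ : _ = (v.1.1, v.1.2, v.2)); last by case: (v) => [[]].
  by rewrite (subr0_eq e1) (subr0_eq e2) (subr0_eq e3).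
split.
  have -> : [set v | herm x v == 0] = [set f t | t in setT].
    apply/setP => v; rewrite inE; apply/eqP/imsetP => [/f_surj[t ->]|[t _ ->]] //.
    by exists t.
  by rewrite card_imset // cardsT card_prod card_F -expnD.
rewrite -(card_binary_isotropic u0 w0 (herm_conj u u) (herm_conj w w)).
rewrite -(card_imset _ f_inj).
apply: eq_card => v; rewrite inE; apply/andP/imsetP => [[/eqP/f_surj[t ->]]|[t]].
  by rewrite hff => t0; exists t; rewrite ?inE.
by rewrite inE -hff => t0 ->; rewrite fx.
Qed.

Hypothesis q_gt1 : (1 < q)%N.

Lemma card_perp_abs (x : point) : ~~ perp x x ->
  #|[set z | perp x z & perp z z]| = q.+1.
Proof.
move=> x0; have [_ c2] := card_conjugate x0.
have Qhom c v : c != 0 ->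
    (herm (val x) (scalev c v) == 0) && (herm (scalev c v) (scalev c v) == 0)
    = (herm (val x) v == 0) && (herm v v == 0).
  by move=> c0; rewrite hermZl !hermZr !mulf_eq0 fmorph_eq0 (negPf c0).
have := card_homogeneous Qhom.
have -> : [set v : vec | (herm (val x) v == 0) && (herm v v == 0) & v != 0]
    = [set v | herm (val x) v == 0 & herm v v == 0] :\ (0 : vec).
  by apply/setP => v; rewrite !inE andbC.
have h0 v : herm v 0 = 0 by rewrite /herm /= rmorph0; ring.
move: c2; rewrite (cardsD1 (0 : vec)) inE !h0 eqxx add1n => /succn_inj-> /eqP.
by rewrite eqn_pmul2l => [/eqP ->|]; [apply: eq_card => z; rewrite !inE | nia].
Qed.

Lemma card_perp (x : point) : ~~ perp x x -> #|[set z | perp x z]| = (q ^ 2).+1.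
Proof.
move=> x0; have [c1 _] := card_conjugate x0.
have Qhom c v : c != 0 -> (herm (val x) (scalev c v) == 0) = (herm (val x) v == 0).
  by move=> c0; rewrite hermZr mulf_eq0 fmorph_eq0 (negPf c0).
have := card_homogeneous Qhom.
have -> : [set v : vec | herm (val x) v == 0 & v != 0]
    = [set v | herm (val x) v == 0] :\ (0 : vec).
  by apply/setP => v; rewrite !inE andbC.
have h0 v : herm v 0 = 0 by rewrite /herm /= rmorph0; ring.
move: c1; rewrite (cardsD1 (0 : vec)) inE h0 eqxx add1n => c1 cE.
have : ((q ^ 2).-1 * #|[set z : point | herm (val x) (val z) == 0%R]|
    = (q ^ 2).-1 * (q ^ 2).+1)%N.
  rewrite -cE; apply/succn_inj; rewrite c1 (expnM q 2 2).
  have : (0 < q ^ 2)%N by rewrite expn_gt0; lia.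
  by case: (q ^ 2)%N => // m _; rewrite -mulnn; lia.
move/eqP; rewrite eqn_pmul2l => [/eqP <-|]; last by nia.
by apply: eq_card => z; rewrite !inE.
Qed.

Lemma card_perp_nonabs (x : point) : ~~ perp x x ->
  #|[set z | perp x z & ~~ perp z z]| = (q * (q - 1))%N.
Proof.
move=> x0; have := cardsID [set z | perp z z] [set z | perp x z].
have -> : [set z | perp x z] :&: [set z | perp z z] = [set z | perp x z & perp z z].
  by apply/setP => z; rewrite !inE.
have -> : [set z | perp x z] :\: [set z | perp z z] = [set z | perp x z & ~~ perp z z].
  by apply/setP => z; rewrite !inE andbC.
by rewrite card_perp_abs // card_perp //; nia.
Qed.

Lemma nonabs_point : exists x : point, ~~ perp x x.
Proof.
have n1 : normed (1, 0, 0) by rewrite /normed /= eqxx.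
exists (exist _ (1, 0, 0) n1 : point).
by rewrite /perp /herm /= rmorph1 rmorph0 !mul0r !addr0 mulr1 oner_neq0.
Qed.

End HermitianPlane.

(** * Conjugation in a field of square order *)

Section QuadraticFrobenius.
Variables (F : finFieldType) (q : nat).
Hypothesis card_F : #|F| = (q ^ 2)%N.
Hypothesis q_gt1 : (1 < q)%N.

Lemma card_expr_eq_le (m : nat) (c : F) : (0 < m)%N ->
  (#|[set x : F | (x ^+ m == c)%R]| <= m)%N.
Proof.
move=> m0; pose p : {poly F} := 'X^m - c%:P.
have sp : size p = m.+1 by rewrite size_XnsubC.
have p0 : p != 0 by rewrite -size_poly_eq0 sp.
rewrite cardE -ltnS -sp; apply: max_poly_roots => //; last exact: enum_uniq.
by apply/allP => x; rewrite mem_enum inE /root /p !hornerE subr_eq0.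
Qed.

(* Each fibre has at most [q + 1] elements and at most [q - 1] values occur, while
   all [q ^ 2 - 1] nonzero elements lie in some fibre: every bound is attained. *)
Lemma card_norm_fiber (c : F) : c != 0 -> c ^+ q = c ->
  #|[set x : F | x * x ^+ q == c]| = q.+1.
Proof.
move=> c0 cq.
pose D := [set d : F | d ^+ q.-1 == 1].
have q1 : q.-1.+1 = q by lia.
have Dle : (#|D| <= q.-1)%N by apply: card_expr_eq_le; lia.
pose fib (d : F) := [set x : F | x ^+ q.+1 == d].
have fible d : (#|fib d| <= q.+1)%N by exact: card_expr_eq_le.
have total : (\sum_(d in D) #|fib d| = q.-1 * q.+1)%N.
  transitivity #|[set~ 0 : F]|; last first.
    by rewrite cardsC1 card_F; nia.
  rewrite -sum1_card [RHS](partition_big (fun x : F => x ^+ q.+1) (mem D)) /=.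
    apply: eq_bigr => d; rewrite inE => d1; rewrite -sum1_card.
    apply: eq_bigl => x; rewrite !inE; have [->|//] := eqVneq x 0.
    rewrite expr0n /=; apply: contraTF d1 => /eqP <-.
    by rewrite expr0n (_ : q.-1 == 0%N = false) ?[0 == 1]eq_sym ?oner_eq0; lia.
  (* Norms of nonzero elements lie in [D], because [(q + 1) * (q - 1)] is the order of the
     multiplicative group. *)
  move=> x; rewrite !inE => x0; rewrite -exprM; apply/eqP.
  have -> : (q.+1 * q.-1 = #|F|.-1)%N by rewrite card_F; nia.
  apply: (mulfI x0); rewrite mulr1 -exprS prednK ?expf_card //.
  by rewrite card_F expn_gt0; lia.
have cD : c \in D.
  by rewrite inE; apply/eqP; apply: (mulfI c0); rewrite mulr1 -exprS q1.
have -> : [set x | x * x ^+ q == c] = fib c by apply/setP => x; rewrite !inE exprS.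
apply/eqP; rewrite eqn_leq fible /=.
(* At most [q - 2] other fibres remain, with at most [q + 1] elements each, so the fibre of [c]
   needs at least [q + 1] to reach the total. *)
move: total; rewrite (bigD1 c cD) /= => total.
have : (\sum_(d in D | d != c) #|fib d| <= \sum_(d in D | d != c) q.+1)%N.
  by apply: leq_sum => d _.
rewrite sum_nat_const.
have -> : #|[pred d in D | d != c]| = #|D :\ c|.
  by apply: eq_card => d; rewrite !inE andbC.
move: total (cardsD1 c D) Dle; rewrite cD; move: (\sum_(i in D | _) _)%N => S.
move: #|D :\ c| #|D| #|fib c| => d' d k total dE dle Sle.
have : (d' * q.+1 <= (q.-1 - 1) * q.+1)%N by apply: leq_mul => //; lia.
nia.
Qed.

(** The trace polynomial has degree [q], too small to vanish on all [q ^ 2] elements. *)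
Lemma exists_trace_neq0 : exists r : F, r + r ^+ q != 0.
Proof.
pose p : {poly F} := 'X^q + 'X.
have sp : size p = q.+1 by rewrite size_polyDl size_polyXn ?size_polyX.
have p0 : p != 0 by rewrite -size_poly_eq0 sp.
case: (pickP (fun r : F => r + r ^+ q != 0)) => [r r0|all0]; first by exists r.
have : all (root p) (enum F).
  by apply/allP => r _; rewrite /root /p !hornerE addrC; apply/negPn; rewrite all0.
move/(max_poly_roots p0)/(_ (enum_uniq _)); rewrite sp -cardE card_F; nia.
Qed.

Hypothesis char_q : [pchar F].-nat q.

(** Since [q] is a power of the characteristic, raising to the power [q] is an iterate of
    Frobenius. *)
Lemma quadratic_conjugation : exists conj : {rmorphism F -> F},
  conj =1 fun x => x ^+ q.
Proof.
pose f (x : F) := x ^+ q.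
have fB : zmod_morphism f.
  by move=> x y; apply: (addIr (f y)); rewrite subrK /f -exprDn_pchar // subrK.
have fM : monoid_morphism f by split=> [|x y]; rewrite /f ?expr1n ?exprMn.
pose isB := GRing.isZmodMorphism.Build F F f fB.
pose isM := GRing.isMonoidMorphism.Build F F f fM.
by exists (HB.pack_for {rmorphism F -> F} f isB isM).
Qed.
End QuadraticFrobenius.

(** * The graph of the Hermitian plane over the field of order [q ^ 2] *)

Theorem theorem10 :
  forall q : nat, prime_power q -> (2 < q)%N ->
  exists e : rel 'I_(q ^ 2 * (q ^ 2 - q + 1)),
    [/\ strongly_deza e (q ^ 2 * (q ^ 2 - q + 1)) (q * (q - 1)) 1 0,
        char_poly (adjmx e) =
          ('X - (q * (q - 1))%N%:R%:P) ^+ 1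
          * ('X - q%:R%:P) ^+ ((q ^ 4 - q) %/ 2 + q ^ 2 - q ^ 3)%N
          * ('X - (-1)%:P) ^+ (q ^ 3)%N
          * ('X - (- q%:R)%:P) ^+ ((q ^ 4 - q) %/ 2 + q - 1 - q ^ 3)%N
      & srg (childA e 1 0) (q ^ 2 * (q ^ 2 - q + 1))
            ((q - 1) * (q + 1) ^ 2) (2 * q ^ 2 - 2) ((q + 1) ^ 2)].
Proof.
move=> q [p [m [p_pr m0 qE]]] q2.
have m20 : (0 < m * 2)%N by rewrite muln_gt0 m0.
have [F Fp cardF] := pPrimePowerField p_pr m20.
have {}cardF : #|F| = (q ^ 2)%N by rewrite cardF qE -expnM.
have qp : [pchar F].-nat q by rewrite qE pnatX pnatE ?Fp.
have q1 : (1 < q)%N by exact: ltnW.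
have [conj conjE] := quadratic_conjugation qp.
have conjK : involutive conj.
  by move=> x; rewrite !conjE -exprM mulnn -cardF expf_card.
have norm c : c != 0 -> conj c = c -> #|[set x | x * conj x == c]| = q.+1.
  rewrite conjE => c0 cq; rewrite -(card_norm_fiber cardF q1 c0 cq).
  by apply: eq_card => x; rewrite !inE conjE.
have trace : exists r, r + conj r != 0.
  by have [r] := exists_trace_neq0 cardF q1; exists r; rewrite conjE.
have [x0 x0P] := nonabs_point conj.
pose S := [pred x : point F | ~~ perp conj x x].
(* The graph results are stated on ordinals of successor form; a nonabsolute point makes [S]
   nonempty. *)
have S0 : #|S|.-1.+1 = #|S| by rewrite prednK //; apply/card_gt0P; exists x0.
pose f (i : 'I_#|S|.-1.+1) : point F := enum_val (cast_ord S0 i).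
have f_inj : injective f by move=> i j /enum_val_inj/cast_ord_inj.
have f_nonabs i : ~~ perp conj (f i) (f i) by exact: (enum_valP (cast_ord S0 i)).
have f_surj x : ~~ perp conj x x -> exists i, f i = x.
  move=> xS; exists (cast_ord (esym S0) (enum_rank_in (A := S) xS x)).
  by rewrite /f cast_ordKV enum_rankK_in.
pose e := polarity_graph (perp conj) f.
have e_sym : symmetric e by move=> i j; rewrite /e /polarity_graph perp_sym.
have e_irr : irreflexive e := polarity_graph_irr f_nonabs.
have e_reg : regular e (q * (q - 1)).
  apply: polarity_graph_regular f_inj f_nonabs f_surj => x xS.
  exact: card_perp_nonabs conjK cardF norm trace q1 x xS.
have meet := perp_meet conjK.
have e_common i j : i != j -> (common_nbrs e i j <= 1)%N.
  exact: polarity_graph_common meet f_inj f_nonabs f_surj i j.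
have abs x : ~~ perp conj x x -> #|[set z | perp conj x z & perp conj z z]| = q.+1.
  exact: card_perp_abs conjK cardF norm trace q1 x.
have e_tan := polarity_graph_tangent (perp_sym conjK) meet abs f_inj f_nonabs f_surj.
(* The nonabsolute points are never counted geometrically: [unital_card] supplies their number and
   moves the goal to the ordinals indexing [f]. *)
rewrite -(unital_card q2 e_sym e_irr e_reg e_common e_tan).
exists e; split.
- exact: unital_strongly_deza.
- exact: unital_char_poly.
- exact: childA_srg.
Qed.
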